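(* Let $\kappa,\tau\in\mathbb{R}$ with $\tau\neq 0$ and $\kappa\neq 4\tau^2$, and let $(M^3,g)=\mathbb{E}(\kappa,\tau)$ with its standard homogeneous metric $g$ and canonical unit vertical Killing field $E_3$. Then every trans-Sasakian structure $(\varphi,\xi,\eta,g)$ on $M$ compatible with $g$ is vertical; more precisely, on each connected component of $M$, $\xi=\pm E_3$. Hence there are no proper trans-Sasakian structures on $M$ compatible with $g$; the only compatible trans-Sasakian structures are the canonical vertical $\alpha$-Sasakian structures (that is, $\xi=\pm E_3$, $\beta=0$, and $\alpha$ is a nonzero constant).
   Context: An almost contact metric structure $(\varphi,\xi,\eta,g)$ on a manifold $M$ consists of a $(1,1)$-tensor field $\varphi$, a vector field $\xi$, a $1$-form $\eta$ and a Riemannian metric $g$ with $\varphi^2=-I+\eta\otimes\xi$, $\eta(\xi)=1$, $\varphi\xi=0$, $\eta\circ\varphi=0$, $g(\varphi X,\varphi Y)=g(X,Y)-\eta(X)\eta(Y)$. It is trans-Sasakian of type $(\alpha,\beta)$ if there are smooth functions $\alpha,\beta$ on $M$ such that for all vector fields $X,Y$ $$(\nabla_X\varphi)Y=\alpha\bigl(g(X,Y)\xi-\eta(Y)X\bigr)+\beta\bigl(g(\varphi X,Y)\xi-\eta(Y)\varphi X\bigr),$$ where $\nabla$ is the Levi-Civita connection of $g$. It is $\alpha$-Sasakian if $\beta=0$ and $\alpha$ is a nonzero constant; $\beta$-Kenmotsu if $\alpha=0$ and $\beta$ is a nonzero constant; cosymplectic if $\alpha=\beta=0$. A trans-Sasakian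 structure is proper if it is none of these three. ''Compatible with $g$'' means that the metric of the structure is the given fixed metric $g$; no homogeneity or invariance of $\varphi,\xi,\eta,\alpha,\beta$ is assumed. For $\tau\ne 0$, $\mathbb{E}(\kappa,\tau)$ is the simply connected oriented homogeneous Riemannian $3$-manifold that fibres by a Riemannian submersion over the simply connected surface $M^2(\kappa)$ of constant curvature $\kappa$, with fibres the integral curves of a unit Killing field $E_3$ and with bundle curvature $\tau$. It carries a global homogeneous orthonormal frame $(E_1,E_2,E_3)$ (it is a simply connected Lie group with a left-invariant metric, the frame being left-invariant) with $E_3$ the vertical Killing field and $$[E_1,E_2]=2\tau E_3,\qquad [E_2,E_3]=\tfrac{\kappa}{2\tau}E_1,\qquad [E_3,E_1]=\tfrac{\kappa}{2\tau}E_2.$$ ''Vertical'' means that $\xi$ is tangent to the fibres. *)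

(* Defs.v *)
From HB Require Import structures.
From mathcomp Require Import all_boot all_order all_algebra.
From mathcomp Require Import boolp classical_sets functions reals topology.
From mathcomp Require Import normedtype derive.
Set Implicit Arguments.
Unset Strict Implicit.
Unset Printing Implicit Defensive.
Import Order.TTheory GRing.Theory Num.Theory.
Import numFieldNormedType.Exports.
Local Open Scope classical_set_scope.
Local Open Scope ring_scope.

(* Smooth manifolds are Hausdorff second countable spaces with a smooth atlas.
   As in Helgason's book, vector fields are the derivations of the algebra of
   smooth functions, and tensor fields are the maps on vector fields that are
   multilinear over the smooth functions. *)

Section Ck.
Variables (R : realType) (n : nat).
Implicit Types (U : set 'rV[R]_n) (f g : 'rV[R]_n -> R).

Definition basis_vec (i : 'I_n) : 'rV[R]_n := delta_mx ord0 i.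

(* Meant for U open: then only the values of f on U matter. *)
Fixpoint Ck (k : nat) U f : Prop :=
  match k with
  | 0 => forall x, U x -> {for x, continuous f}
  | k'.+1 => (forall x, U x -> {for x, continuous f}) /\
      forall i : 'I_n, (forall x, U x -> derivable f x (basis_vec i)) /\
                       Ck k' U (fun x => derive f x (basis_vec i))
  end.

Definition smooth_on U f := forall k, Ck k U f.

Lemma Ck_continuous k U f x : Ck k U f -> U x -> {for x, continuous f}.
Proof. by case: k => [|k] /=; [exact|case=> + _; exact]. Qed.

Lemma CkS k U f : Ck k.+1 U f -> Ck k U f.
Proof.
elim: k f => [|k IH] f; first by case.
case=> cf Hf; split=> // i; have [df Df] := Hf i; split=> //; exact: IH.
Qed.

Lemma Ck_eq k U f g : open U -> (forall x, U x -> f x = g x) ->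
  Ck k U f -> Ck k U g.
Proof.
move=> oU.
have nfg (h h' : 'rV[R]_n -> R) : (forall x, U x -> h x = h' x) ->
    forall x, U x -> \forall y \near x, h y = h' y.
  move=> hh' x Ux; have /filterS : nbhs x U by exact: open_nbhs_nbhs.
  by apply=> y; exact: hh'.
have ceq (h h' : 'rV[R]_n -> R) : (forall x, U x -> h x = h' x) ->
    (forall x, U x -> {for x, continuous h}) ->
    (forall x, U x -> {for x, continuous h'}).
  move=> hh' ch x Ux; rewrite /prop_for /continuous_at -(hh' _ Ux).
  exact: cvg_trans (near_eq_cvg (nfg _ _ hh' x Ux)) (ch x Ux).
elim: k f g => [|k IH] f g fg /=; first exact: ceq.
case=> cf H; split; first exact: ceq cf.
move=> i; have [df Df] := H i; split.
  by move=> x Ux; apply: near_eq_derivable (df x Ux); exact: nfg Ux.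
by apply: IH Df => x Ux; apply: near_eq_derive; exact: nfg Ux.
Qed.

Lemma Ck_cst k U (c : R) : Ck k U (fun=> c).
Proof.
elim: k c => [|k IH] c /=; first by move=> x _; exact: cst_continuous.
split; first by move=> x _; exact: cst_continuous.
move=> i; split; first by move=> x _; exact: derivable_cst.
have -> : (fun x => derive (fun=> c : R) x (basis_vec i)) = fun=> 0.
  by apply/funext => x; exact: derive_cst.
exact: IH.
Qed.

Lemma CkD k U f g : open U -> Ck k U f -> Ck k U g ->
  Ck k U (fun x => f x + g x).
Proof.
move=> oU; elim: k f g => [|k IH] f g /=.
  by move=> cf cg x Ux; apply: continuousD; [exact: cf|exact: cg].
case=> cf Hf [cg Hg]; split.
  by move=> x Ux; apply: continuousD; [exact: cf|exact: cg].
move=> i; have [df Df] := Hf i; have [dg Dg] := Hg i; split.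
  by move=> x Ux; apply: derivableD; [exact: df|exact: dg].
apply: Ck_eq (IH _ _ Df Dg) => // x Ux.
by rewrite -deriveD; [|exact: df|exact: dg].
Qed.

Lemma CkM k U f g : open U -> Ck k U f -> Ck k U g ->
  Ck k U (fun x => f x * g x).
Proof.
move=> oU; elim: k f g => [|k IH] f g.
  by move=> cf cg x Ux; apply: continuousM; [exact: cf|exact: cg].
move=> Cf Cg; have [cf Hf] := Cf; have [cg Hg] := Cg; split.
  by move=> x Ux; apply: continuousM; [exact: cf|exact: cg].
move=> i; have [df Df] := Hf i; have [dg Dg] := Hg i; split.
  by move=> x Ux; apply: derivableM; [exact: df|exact: dg].
apply: (@Ck_eq k U (fun x => f x * 'D_(basis_vec i) g x +
                             g x * 'D_(basis_vec i) f x)) => //.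
  by move=> x Ux; rewrite (deriveM (df x Ux) (dg x Ux)).
by apply: CkD => //; apply: IH => //; exact: CkS.
Qed.

End Ck.

Record chart (R : realType) (n : nat) (T : topologicalType) := Chart {
  cdom : set T ;
  cmap : T -> 'rV[R]_n ;
  cinv : 'rV[R]_n -> T ;
  cdom_open : open cdom ;
  ccod_open : open (cmap @` cdom) ;
  cmapK : forall p, cdom p -> cinv (cmap p) = p ;
  cmap_cont : forall p, cdom p -> {for p, continuous cmap} ;
  cinv_cont : forall x, (cmap @` cdom) x -> {for x, continuous cinv} }.

Arguments cdom_open {R n T} c.
Arguments ccod_open {R n T} c.

Record manifold (R : realType) (n : nat) := Manifold {
  msort :> topologicalType ;
  atlas : set (chart R n msort) ;
  mfld_hausdorff : hausdorff_space msort ;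
  mfld_second_countable : @second_countable msort ;
  atlas_cover : forall p : msort, exists2 c, atlas c & cdom c p ;
  atlas_compat : forall c c', atlas c -> atlas c' -> forall i : 'I_n,
    smooth_on (cmap c @` (cdom c `&` cdom c'))
              (fun x => cmap c' (cinv c x) ord0 i) }.

(* The algebra of smooth functions. *)
Section SmoothFunctions.
Variables (R : realType) (n : nat) (M : manifold R n).

Definition smooth (f : M -> R) : Prop :=
  forall c, atlas c -> smooth_on (cmap c @` cdom c) (f \o cinv c).

Definition smooth_pred : {pred M -> R} := fun f => `[< smooth f >].

Lemma smooth_subring : subring_closed smooth_pred.
Proof.
split.
- by apply/asboolP => c _ k; exact: Ck_cst.
- move=> f g /asboolP sf /asboolP sg; apply/asboolP => c ac k.
  have oc := ccod_open c.
  apply: (Ck_eq oc _ (CkD oc (sf c ac k)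
    (CkM oc (Ck_cst k _ (-1)) (sg c ac k)))) => x _ /=.
  by rewrite mulN1r.
- move=> f g /asboolP sf /asboolP sg; apply/asboolP => c ac k.
  exact: (CkM (ccod_open c) (sf c ac k) (sg c ac k)).
Qed.

Lemma smooth_scaler : GRing.scaler_closed smooth_pred.
Proof.
move=> a f /asboolP sf; apply/asboolP => c ac k.
exact: (CkM (ccod_open c) (Ck_cst k _ a) (sf c ac k)).
Qed.

HB.instance Definition _ :=
  GRing.isSubringClosed.Build (M -> R) smooth_pred smooth_subring.
HB.instance Definition _ :=
  GRing.isScaleClosed.Build R (M -> R) smooth_pred smooth_scaler.

Record Cinf := MkCinf { cfun :> M -> R ; _ : cfun \in smooth_pred }.

HB.instance Definition _ := [isSub for cfun].
HB.instance Definition _ := [Choice of Cinf by <:].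
HB.instance Definition _ := 
  GRing.SubChoice_isSubComPzRing.Build _ _ Cinf (subringClosedP _).
HB.instance Definition _ := [SubZmodule_isSubLmodule of Cinf by <:].

Definition cstC (c : R) : Cinf := c *: (1 : Cinf).

Lemma Cinf_scaleAr (a : R) (f g : Cinf) : f * (a *: g) = a *: (f * g).
Proof.
by apply: val_inj; apply/funext => x /=; exact: mulrCA.
Qed.

End SmoothFunctions.

(* Vector fields, as a module over the smooth functions. *)
Section VectorFields.
Variables (R : realType) (n : nat) (M : manifold R n).
Local Notation C := (Cinf M).

Definition derivation (X : C -> C^o) : Prop :=
  (forall (a : R) (f h : C), X (a *: f + h) = a *: (X f : C) + X h) /\
  (forall f h : C, X (f * h) = f * X h + h * X f).

Definition derivation_pred : {pred C -> C^o} := fun X => `[< derivation X >].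

Lemma derivation_submod : submod_closed derivation_pred.
Proof.
split=> [|u X Y /asboolP[lX dX] /asboolP[lY dY]]; apply/asboolP.
  split=> [a f h|f h].
    by change (0 = a *: (0 : C) + (0 : C)); rewrite scaler0 addr0.
  by change (0 = f * (0 : C) + h * (0 : C)); rewrite !mulr0 addr0.
split=> [a f h|f h] /=.
  change (u * X (a *: f + h) + Y (a *: f + h) =
          a *: (u * X f + Y f : C) + (u * X h + Y h)).
  rewrite lX lY mulrDr Cinf_scaleAr scalerDr -!addrA; congr (_ + _).
  by rewrite addrCA.
change (u * X (f * h) + Y (f * h) =
        f * (u * X h + Y h) + h * (u * X f + Y f)).
rewrite dX dY !mulrDr !(mulrCA u) -!addrA; congr (_ + _).
by rewrite addrCA.
Qed.

HB.instance Definition _ :=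
  GRing.isSubmodClosed.Build C (C -> C^o) derivation_pred derivation_submod.

Record vfield := MkVfield { vfun :> C -> C^o ; _ : vfun \in derivation_pred }.

HB.instance Definition _ := [isSub for vfun].
HB.instance Definition _ := [Choice of vfield by <:].
HB.instance Definition _ := [SubChoice_isSubLmodule of vfield by <:].

Lemma lie_subproof (X Y : vfield) :
  (fun f => X (Y f) - Y (X f)) \in derivation_pred.
Proof.
have /asboolP[lX dX] := valP X; have /asboolP[lY dY] := valP Y.
apply/asboolP; split=> [a f h|f h] /=.
  change (X (Y (a *: f + h)) - Y (X (a *: f + h)) =
          a *: (X (Y f) - Y (X f) : C) + (X (Y h) - Y (X h))).
  by rewrite lX lY lX lY scalerBr opprD addrACA.
change (X (Y (f * h)) - Y (X (f * h)) =
        f * (X (Y h) - Y (X h)) + h * (X (Y f) - Y (X f))).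
have addX a b : X (a + b) = X a + X b by have := lX 1 a b; rewrite !scale1r.
have addY a b : Y (a + b) = Y a + Y b by have := lY 1 a b; rewrite !scale1r.
have E (a b c d p q : C) :
    a + p + (b + q) - (c + q + (d + p)) = a - c + (b - d).
  rewrite (addrACA a p b q) (addrACA c q d p) (addrC q p) opprD.
  by rewrite (addrACA (a + b) (p + q)) subrr addr0 opprD addrACA.
rewrite dX dY addX addY !dX !dY !mulrBr (mulrC (\val X f)) (mulrC (\val X h)).
exact: E.
Qed.

Definition lie (X Y : vfield) : vfield := MkVfield (lie_subproof X Y).

Definition tangent (p : M) (v : C -> R) : Prop :=
  (forall (a : R) (f h : C), v (a *: f + h) = a * v f + v h) /\
  (forall f h : C, v (f * h) = f p * v h + h p * v f).

Definition frame (I : finType) (E : I -> vfield) : Prop :=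
  forall (p : M) (v : C -> R), tangent p v ->
  exists! c : {ffun I -> R}, forall f : C, v f = \sum_i c i * E i f p.

End VectorFields.

Section Riemannian.
Variables (R : realType) (n : nat) (M : manifold R n).
Local Notation C := (Cinf M).
Local Notation vf := (vfield M).

Record metric := Metric {
  inner :> vf -> vf -> C ;
  inner_linear : forall (f : C) (X Y Z : vf),
    inner (f *: X + Y) Z = f * inner X Z + inner Y Z ;
  inner_sym : forall X Y : vf, inner X Y = inner Y X ;
  inner_ge0 : forall (X : vf) (p : M), 0 <= inner X X p ;
  inner_eq0 : forall (X : vf) (p : M),
    inner X X p = 0 <-> (forall f : C, X f p = 0) }.

Record connection := Connection {
  nabla :> vf -> vf -> vf ;
  nabla_linear : forall (f : C) (X Y Z : vf),
    nabla (f *: X + Y) Z = f *: nabla X Z + nabla Y Z ;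
  nabla_add : forall X Y Z : vf, nabla X (Y + Z) = nabla X Y + nabla X Z ;
  nabla_leibniz : forall (f : C) (X Y : vf),
    nabla X (f *: Y) = (X f : C) *: Y + f *: nabla X Y }.

Definition levi_civita (g : metric) (D : connection) : Prop :=
  (forall X Y : vf, D X Y - D Y X = lie X Y) /\
  (forall X Y Z : vf, X (g Y Z) = g (D X Y) Z + g Y (D X Z)).

Record almost_contact (g : metric) := AlmostContact {
  phi : {linear vf -> vf} ;
  xi : vf ;
  eta : {linear vf -> C^o} ;
  phi_phi : forall X : vf, phi (phi X) = - X + (eta X : C) *: xi ;
  eta_xi : eta xi = 1 ;
  phi_xi : phi xi = 0 ;
  eta_phi : forall X : vf, eta (phi X) = 0 ;
  phi_metric : forall X Y : vf, g (phi X) (phi Y) = g X Y - eta X * eta Y }.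

Section TransSasakian.
Variables (g : metric) (D : connection).

Definition trans_sasakian_type (S : almost_contact g) (alpha beta : C) : Prop :=
  forall X Y : vf,
    D X (phi S Y) - phi S (D X Y) =
      alpha *: (g X Y *: xi S - (eta S Y : C) *: X) +
      beta *: (g (phi S X) Y *: xi S - (eta S Y : C) *: phi S X).

Definition nonzero_constant (f : C) : Prop :=
  exists2 c : R, c != 0 & f = cstC M c.

Definition trans_sasakian (S : almost_contact g) : Prop :=
  exists alpha beta : C, trans_sasakian_type S alpha beta.

Definition alpha_sasakian (S : almost_contact g) : Prop :=
  exists2 alpha : C, trans_sasakian_type S alpha 0 & nonzero_constant alpha.

Definition beta_kenmotsu (S : almost_contact g) : Prop :=
  exists2 beta : C, trans_sasakian_type S 0 beta & nonzero_constant beta.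

Definition cosymplectic (S : almost_contact g) : Prop :=
  trans_sasakian_type S 0 0.

Definition proper_trans_sasakian (S : almost_contact g) : Prop :=
  [/\ trans_sasakian S, ~ alpha_sasakian S, ~ beta_kenmotsu S &
      ~ cosymplectic S].

End TransSasakian.

End Riemannian.

Section SimplyConnected.
Variables (R : realType) (T : topologicalType).

Definition unit_itv : set R := [set t | 0 <= t <= 1].

Definition path_between (x y : T) (c : R -> T) : Prop :=
  [/\ {within unit_itv, continuous c}, c 0 = x & c 1 = y].

Definition homotopic (x y : T) (c c' : R -> T) : Prop :=
  exists H : R * R -> T,
  [/\ {within unit_itv `*` unit_itv, continuous H},
      forall t, unit_itv t -> H (0, t) = c t,
      forall t, unit_itv t -> H (1, t) = c' t &
      forall s, unit_itv s -> H (s, 0) = x /\ H (s, 1) = y].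

Definition simply_connected : Prop :=
  [/\ exists x : T, True,
      forall x y : T, exists c, path_between x y c &
      forall x y c c', path_between x y c -> path_between x y c' ->
        homotopic x y c c'].

End SimplyConnected.

Record lie_group (R : realType) (n : nat) := LieGroup {
  lg_mfld :> manifold R n ;
  lmul : lg_mfld -> lg_mfld -> lg_mfld ;
  linv : lg_mfld -> lg_mfld ;
  lone : lg_mfld ;
  lmulA : associative lmul ;
  lmul1 : left_id lone lmul ;
  lmulV : left_inverse lone linv lmul ;
  lmul_cont : continuous (fun p : lg_mfld * lg_mfld => lmul p.1 p.2) ;
  linv_cont : continuous linv ;
  (* In product charts; a point of 'rV_(n + n) is a pair of points of 'rV_n. *)
  lmul_smooth : forall c1 c2 c3 : chart R n lg_mfld,
    atlas c1 -> atlas c2 -> atlas c3 -> forall i : 'I_n,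
    let m (z : 'rV[R]_(n + n)) :=
      lmul (cinv c1 (lsubmx z)) (cinv c2 (rsubmx z)) in
    smooth_on [set z | [/\ (cmap c1 @` cdom c1) (lsubmx z),
                           (cmap c2 @` cdom c2) (rsubmx z) & cdom c3 (m z)]]
              (fun z => cmap c3 (m z) ord0 i) ;
  linv_smooth : forall c c' : chart R n lg_mfld,
    atlas c -> atlas c' -> forall i : 'I_n,
    smooth_on [set x | (cmap c @` cdom c) x /\ cdom c' (linv (cinv c x))]
              (fun x => cmap c' (linv (cinv c x)) ord0 i) }.

(* h is the pullback of f by the left translation by a. *)
Definition left_invariant (R : realType) (n : nat) (G : lie_group R n)
    (X : vfield G) : Prop :=
  forall (a : G) (f h : Cinf G), (forall q, h q = f (lmul a q)) ->
  forall q, X h q = X f (lmul a q).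

Definition idx1 : 'I_3 := @Ordinal 3 0 isT.
Definition idx2 : 'I_3 := @Ordinal 3 1 isT.
Definition idx3 : 'I_3 := @Ordinal 3 2 isT.

(* The models of E(kappa, tau), tau != 0, with their homogeneous frame and
   metric; a simply connected Lie group is determined up to isomorphism by its
   Lie algebra, so that any two of them are isomorphic as Lie groups, by an
   isometry which respects the frames. *)
Record Ekt (R : realType) (kappa tau : R) := MkEkt {
  Egroup :> lie_group R 3 ;
  E_simply_connected : simply_connected R Egroup ;
  Efr : 'I_3 -> vfield Egroup ;
  E_left_invariant : forall i, left_invariant (Efr i) ;
  E_frame : frame Efr ;
  E_bracket12 :
    lie (Efr idx1) (Efr idx2) = cstC Egroup (2 * tau) *: Efr idx3 ;
  E_bracket23 :
    lie (Efr idx2) (Efr idx3) = cstC Egroup (kappa / (2 * tau)) *: Efr idx1 ;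
  E_bracket31 :
    lie (Efr idx3) (Efr idx1) = cstC Egroup (kappa / (2 * tau)) *: Efr idx2 ;
  Emetric : metric Egroup ;
  E_orthonormal : forall i j, Emetric (Efr i) (Efr j) = (i == j)%:R }.

Section EktFields.
Variables (R : realType) (kappa tau : R) (M : Ekt kappa tau).

Definition E3 : vfield M := Efr M idx3.

(* The fibres are the integral curves of E3. *)
Definition vertical (X : vfield M) : Prop :=
  forall p : M, exists c : R, forall f : Cinf M, X f p = c * E3 f p.

End EktFields.

(* Main.v *)
Require Import Defs.
From HB Require Import structures.
From mathcomp Require Import all_boot all_order all_algebra.
From mathcomp Require Import boolp classical_sets functions reals topology.
From mathcomp Require Import normedtype derive.
From mathcomp Require Import realfun ring lra.
Set Implicit Arguments.
Unset Strict Implicit.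
Unset Printing Implicit Defensive.
Import Order.TTheory GRing.Theory Num.Theory.
Import numFieldNormedType.Exports.
Local Open Scope ring_scope.

(* For a trans-Sasakian structure, nabla_X xi = - alpha phi X - beta phi^2 X and
   nabla_xi phi = 0, so that R(X, xi) xi is a combination of phi X and phi^2 X
   and X |-> g(R(X, xi) xi, X) is a multiple of |X|^2 - eta(X)^2 = |xi x X|^2
   (cross product). In E(kappa, tau) this quadratic form is
   tau^2 |xi x X|^2 + (kappa - 4 tau^2) g(xi x X, E3)^2; the rank one term must
   be a multiple of |xi x X|^2, so xi is parallel to E3. As M is connected, the
   factor is a constant sign, and comparing the formula for nabla xi with
   nabla_E1 E3 = - tau E2 gives beta = 0 and alpha^2 = tau^2. *)

(** * Calculus of functions and vector fields, connections and curvature *)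

Section Riemannian.
Variables (R : realType) (n : nat) (M : manifold R n).
Implicit Types (f h : Cinf M) (X Y Z : vfield M).

Lemma cfunP f h : (forall p, f p = h p) -> f = h.
Proof. by move=> fh; apply: val_inj; apply/funext. Qed.

Lemma cfunD f h p : (f + h) p = f p + h p.
Proof. by []. Qed.

Lemma cfunM f h p : (f * h) p = f p * h p.
Proof. by []. Qed.

Lemma cfunN f p : (- f) p = - f p.
Proof. by []. Qed.

Lemma cfun0 p : (0 : Cinf M) p = 0.
Proof. by []. Qed.

Lemma cfun1 p : (1 : Cinf M) p = 1.
Proof. by []. Qed.

Lemma cfun_cst c p : cstC M c p = c.
Proof. exact: mulr1. Qed.

Lemma vfunP X Y : (forall f p, X f p = Y f p) -> X = Y.
Proof.
by move=> XY; apply: val_inj; apply/funext => f; apply: cfunP; exact: XY.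
Qed.

Lemma vfunD X Y f p : (X + Y) f p = X f p + Y f p.
Proof. by []. Qed.

Lemma vfunZ h X f p : (h *: X) f p = h p * X f p.
Proof. by []. Qed.

Lemma vfunN X f p : (- X) f p = - X f p.
Proof. by []. Qed.

Lemma vfun0 f p : (0 : vfield M) f p = 0.
Proof. by []. Qed.

Definition vfunE := (vfunD, vfunN, vfunZ, vfun0).
Definition cfunE := (cfunD, cfunM, cfunN, cfun0, cfun1, cfun_cst).

Lemma cstCN c : cstC M (- c) = - cstC M c.
Proof. by apply: cfunP => p; rewrite !cfunE. Qed.

Lemma cstC1 : cstC M 1 = 1.
Proof. by apply: cfunP => p; rewrite !cfunE. Qed.

Lemma vfun_linear X (a : R) f h : X (a *: f + h) = a *: (X f : Cinf M) + X h.
Proof. by have /asboolP[lX _] := valP X; exact: lX. Qed.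

Lemma vfun_add X f h : X (f + h) = X f + X h :> Cinf M.
Proof. by have := vfun_linear X 1 f h; rewrite !scale1r. Qed.

Lemma vfun_mul X f h : X (f * h) = f * X h + h * X f :> Cinf M.
Proof. by have /asboolP[_ dX] := valP X; exact: dX. Qed.

Lemma vfun_cst X c : X (cstC M c) = 0.
Proof.
have X1 : X 1 = 0.
  by have /eqP := vfun_mul X 1 1; rewrite !mul1r eq_sym -subr_eq0 addrK => /eqP.
have X0 : X 0 = 0.
  by have /eqP := vfun_add X 0 0; rewrite addr0 eq_sym -subr_eq0 addrK => /eqP.
by have := vfun_linear X c 1 0; rewrite X1 X0 !addr0 scaler0.
Qed.

Variables (g : metric M) (D : connection M).

Lemma innerDl X Y Z : g (X + Y) Z = g X Z + g Y Z.
Proof. by rewrite -[X in g (X + _) _]scale1r inner_linear mul1r. Qed.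

Lemma inner0l Z : g 0 Z = 0.
Proof.
by have /eqP := innerDl 0 0 Z; rewrite addr0 eq_sym -subr_eq0 addrK => /eqP.
Qed.

Lemma innerZl f X Z : g (f *: X) Z = f * g X Z.
Proof. by rewrite -[f *: X]addr0 inner_linear inner0l addr0. Qed.

Lemma innerNl X Z : g (- X) Z = - g X Z.
Proof. by rewrite -scaleN1r innerZl mulN1r. Qed.

Lemma innerDr X Y Z : g Z (X + Y) = g Z X + g Z Y.
Proof. by rewrite !(inner_sym _ Z) innerDl. Qed.

Lemma innerZr f X Z : g Z (f *: X) = f * g Z X.
Proof. by rewrite !(inner_sym _ Z) innerZl. Qed.

Lemma innerNr X Z : g Z (- X) = - g Z X.
Proof. by rewrite !(inner_sym _ Z) innerNl. Qed.

Lemma inner0r Z : g Z 0 = 0.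
Proof. by rewrite inner_sym inner0l. Qed.

Definition innerE := (innerDl, innerNl, innerZl, inner0l,
                      innerDr, innerNr, innerZr, inner0r).

Lemma nablaDl X Y Z : D (X + Y) Z = D X Z + D Y Z.
Proof. by rewrite -[X in D (X + _) _]scale1r nabla_linear scale1r. Qed.

Lemma nabla0l Z : D 0 Z = 0.
Proof.
by have /eqP := nablaDl 0 0 Z; rewrite addr0 eq_sym -subr_eq0 addrK => /eqP.
Qed.

Lemma nablaZl f X Z : D (f *: X) Z = f *: D X Z.
Proof. by rewrite -[f *: X]addr0 nabla_linear nabla0l addr0. Qed.

Lemma nablaNl X Z : D (- X) Z = - D X Z.
Proof. by rewrite -scaleN1r nablaZl scaleN1r. Qed.

Lemma nablaZr c X Z : D Z (cstC M c *: X) = cstC M c *: D Z X.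
Proof. by rewrite nabla_leibniz vfun_cst scale0r add0r. Qed.

Lemma nabla0r Z : D Z 0 = 0.
Proof.
by have /eqP := nabla_add D Z 0 0; rewrite addr0 eq_sym -subr_eq0 addrK => /eqP.
Qed.

Lemma nablaNr X Z : D Z (- X) = - D Z X.
Proof.
have E : cstC M (-1) = -1 by rewrite cstCN cstC1.
by rewrite -(scaleN1r X) -E nablaZr E scaleN1r.
Qed.

Definition nablaE := (nablaDl, nablaNl, nablaZl, nabla0l,
                      nabla_add, nablaNr, nablaZr, nabla0r).

Definition curvature X Y Z : vfield M :=
  D X (D Y Z) - D Y (D X Z) - D (lie X Y) Z.

Hypothesis torsion_free : forall X Y, D X Y - D Y X = lie X Y.

(** Torsion freeness replaces [lie] by covariant derivatives, so that the linearity of [D] is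
    enough. *)
Lemma curvatureDm X Y Y' Z :
  curvature X (Y + Y') Z = curvature X Y Z + curvature X Y' Z.
Proof.
rewrite /curvature -!torsion_free !nablaE.
by apply: vfunP => h p; rewrite !vfunE; ring.
Qed.

Lemma curvatureZm f X Y Z : curvature X (f *: Y) Z = f *: curvature X Y Z.
Proof.
rewrite /curvature -!torsion_free !nablaE !nabla_leibniz !nablaE.
by apply: vfunP => h p; rewrite !vfunE; ring.
Qed.

Lemma curvatureDr X Y Z Z' :
  curvature X Y (Z + Z') = curvature X Y Z + curvature X Y Z'.
Proof.
by rewrite /curvature !nablaE; apply: vfunP => h p; rewrite !vfunE; ring.
Qed.

Lemma curvatureZr f X Y Z : curvature X Y (f *: Z) = f *: curvature X Y Z.
Proof.
rewrite /curvature !nabla_leibniz !nablaE !nabla_leibniz.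
apply: vfunP => h p; rewrite !vfunE.
(* The second derivatives of [f] left by the Leibniz rule cancel against the derivative of [f] along
   [lie X Y]. *)
have -> : lie X Y f p = X (Y f) p - Y (X f) p by [].
by ring.
Qed.

Hypothesis metric_compat : forall X Y Z, X (g Y Z) = g (D X Y) Z + g Y (D X Z).

(** * Almost contact and trans-Sasakian identities *)

Variable S : almost_contact g.
Local Notation ph := (phi S).
Local Notation xi := (xi S).
Local Notation et := (Defs.eta S).

Lemma eta_inner X : et X = g X xi.
Proof.
have := phi_metric S X xi.
by rewrite phi_xi inner0r eta_xi mulr1 => /esym/eqP; rewrite subr_eq0 => /eqP ->.
Qed.

Lemma inner_xi : g xi xi = 1.
Proof. by rewrite -eta_inner eta_xi. Qed.

Lemma inner_phi_xi X : g (ph X) xi = 0.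
Proof. by rewrite -eta_inner eta_phi. Qed.

Lemma phiN X : ph (- X) = - ph X.
Proof. exact: linearN. Qed.

Lemma phi3 X : ph (ph (ph X)) = - ph X.
Proof. by rewrite phi_phi eta_phi scale0r addr0. Qed.

(** Compatibility is applied to [ph X] and [Y]: up to a multiple of [xi], which is orthogonal to
    [ph Y], [ph (ph X)] is [- X]. *)
Lemma phi_skew X Y : g (ph X) Y = - g X (ph Y).
Proof.
have := phi_metric S (ph X) Y.
rewrite eta_phi mul0r subr0 => <-.
by rewrite phi_phi !innerE (inner_sym g xi) inner_phi_xi mulr0 addr0.
Qed.

Lemma inner_phi X : g (ph X) X = 0.
Proof.
apply: cfunP => p; have := congr1 (fun f : Cinf M => f p) (phi_skew X X).
by rewrite (inner_sym g X) !cfunE; lra.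
Qed.

Variables alpha beta : Cinf M.
Hypothesis tS : trans_sasakian_type D S alpha beta.

Lemma inner_nabla_xi X : g (D X xi) xi = 0.
Proof.
have := metric_compat X xi xi; rewrite inner_xi -cstC1 vfun_cst (inner_sym g xi).
move=> E; apply: cfunP => p; have := congr1 (fun f : Cinf M => f p) E.
by rewrite !cfunE; lra.
Qed.

(** At [Y = xi] the structure equation gives [ph (D X xi)]. Applying [ph] again recovers [D X xi],
    which is orthogonal to [xi] because [xi] has constant length. *)
Lemma nabla_xi X : D X xi = - (alpha *: ph X) - beta *: ph (ph X).
Proof.
have := congr1 (phi S) (tS X xi).
rewrite phi_xi nabla0r sub0r linearN /= (phi_phi _ (D X xi)) eta_xi.
rewrite eta_inner inner_nabla_xi scale0r inner_phi_xi !scale1r scale0r addr0.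
rewrite opprK sub0r => ->; rewrite linearD !linearZ /= linearB linearN linearZ /=.
by rewrite phi_xi scaler0 !sub0r !scalerN.
Qed.

(** In the direction [xi] both brackets of the structure equation vanish, by [g xi X = et X] and
    [ph xi = 0]. *)
Lemma nabla_xi_phi X : D xi (ph X) = ph (D xi X).
Proof.
apply/eqP; rewrite -subr_eq0 tS eta_inner phi_xi inner0l (inner_sym g xi).
by rewrite subrr scale0r !scaler0 subrr scaler0 addr0.
Qed.

(** Only the [ph (ph X)] part of the curvature contributes, since [ph X] is orthogonal to [X]. *)
Lemma curvature_xi X : g (curvature X xi xi) X =
  (alpha ^+ 2 - beta ^+ 2 - xi beta) * (g X X - g X xi ^+ 2).
Proof.
have -> : curvature X xi xi =
    (xi alpha + 2 * alpha * beta) *: ph X +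
    (xi beta - alpha ^+ 2 + beta ^+ 2) *: ph (ph X).
  rewrite /curvature -torsion_free.
  (* [xi] is geodesic, which removes the term [D X (D xi xi)]. *)
  have -> : D xi xi = 0 by rewrite nabla_xi phi_xi !(linear0, oppr0, subr0).
  rewrite [D X xi]nabla_xi !nablaE !nabla_leibniz !nabla_xi !nabla_xi_phi.
  by rewrite !phi3 phiN; apply: vfunP => h p; rewrite !vfunE !cfunE; ring.
rewrite !innerE inner_phi phi_phi !innerE eta_inner (inner_sym g xi).
by ring.
Qed.

End Riemannian.

(** * Orthonormal expansions and functions of constant square *)

Section Manifold.
Variables (R : realType) (n : nat) (M : manifold R n).
Implicit Types (f h : Cinf M) (X Y Z : vfield M).

(** [frame] gives coefficients point by point, with no smoothness. At a fixed [p] the remainder [Y]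
    is therefore compared with a constant-coefficient field [W] that agrees with it at [p]; as [Y]
    is orthogonal to [W], Pythagoras gives [Y = 0] at [p]. *)
Lemma orthonormal_expansion (g : metric M) (I : finType) (E : I -> vfield M) :
  frame E -> (forall i j, g (E i) (E j) = (i == j)%:R) ->
  forall X, X = \sum_i g X (E i) *: E i.
Proof.
move=> frE orE X.
have inner_sum Y (F : I -> vfield M) : g Y (\sum_i F i) = \sum_i g Y (F i).
  by apply: (big_morph (g Y)) => [Z Z'|]; rewrite ?innerDr ?inner0r.
pose Y : vfield M := X - \sum_i g X (E i) *: E i.
have YE j : g Y (E j) = 0.
  rewrite /Y innerDl innerNl (inner_sym g (\sum_i _)) inner_sum.
  rewrite (bigD1 j) //= big1 ?addr0 => [|i /negPf ij].
    by rewrite innerZr orE eqxx mulr1 subrr.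
  by rewrite innerZr orE eq_sym ij mulr0.
apply/eqP; rewrite -subr_eq0; apply/eqP; apply: (@vfunP _ _ _ Y) => f p.
have tY : tangent p (fun f => Y f p).
  split=> [a u v|u v]; first by rewrite vfun_linear.
  by rewrite vfun_mul.
have [c [Yc _]] := frE _ _ tY.
pose W : vfield M := \sum_i cstC M (c i) *: E i.
have WE u : W u p = \sum_i c i * E i u p.
  rewrite /W (big_morph (fun Z : vfield M => Z u p) (id1 := 0) (op1 := +%R)) //.
  by apply: eq_bigr => i _; rewrite vfunZ cfun_cst.
have YW : g Y W = 0.
  by rewrite inner_sum big1 // => i _; rewrite innerZr YE mulr0.
(* Otherwise [innerE] would rewrite inside the bodies of W and Y. *)
clearbody W Y.
have : g (Y - W) (Y - W) p = 0.
  by apply/inner_eq0 => u; rewrite vfunD vfunN WE Yc subrr.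
rewrite !innerE (inner_sym g W Y) YW oppr0 add0r addr0 opprK cfunD => e.
have : g Y Y p = 0 by have := inner_ge0 g Y p; have := inner_ge0 g W p; lra.
by move=> /inner_eq0 ->; rewrite vfun0.
Qed.

(** In a chart around [p] this is the order [0] case of smoothness. *)
Lemma cfun_continuous f : continuous (f : M -> R).
Proof.
move=> p; have [c ac cp] := atlas_cover p.
have /asboolP sf := valP f.
have cfp := sf c ac 0%N (cmap c p) (ex_intro2 _ _ p cp erefl).
have cont : {for p, continuous ((f \o cinv c) \o cmap c)}.
  by apply: continuous_comp; [exact: cmap_cont|exact: cfp].
have near_eq : \forall q \near p, ((f \o cinv c) \o cmap c) q = f q.
  have := open_nbhs_nbhs (conj (cdom_open c) cp).
  by apply: filterS => q cq /=; rewrite cmapK.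
rewrite /continuous_at -{2}(cmapK cp).
exact: cvg_trans (near_eq_cvg near_eq) cont.
Qed.

(** Two distinct values of [f] would be opposite and nonzero, so [f] would vanish somewhere on a
    path joining the two points, against the constancy of its square. *)
Lemma cfun_sqr_cst f (c : R) : simply_connected R M ->
  f * f = cstC M (c ^+ 2) -> f = cstC M c \/ f = cstC M (- c).
Proof.
move=> [[x0 _] pathM _] ff.
have fE p : f p * f p = c ^+ 2 by rewrite -(cfun_cst (c ^+ 2) p) -ff.
have fC x y : f x = f y.
  apply/eqP/negPn/negP => fxy.
  have [gam [cgam g0 g1]] := pathM x y.
  have fN : f y = - f x.
    have /eqP : (f x - f y) * (f x + f y) = 0.
      by have := fE x; have := fE y; nra.
    by rewrite mulf_eq0 subr_eq0 (negPf fxy) /= addrC addr_eq0 => /eqP.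
  have fx0 : f x != 0 by apply: contra fxy => /eqP e; rewrite fN e oppr0.
  have [] := @IVT R (f \o gam) 0 1 0 ler01.
  - have -> : [set` `[0, 1]%R]%classic = @unit_itv R.
      by apply/seteqP; split => t; rewrite /unit_itv /= in_itv.
    move=> t; apply: (@continuous_comp (subspace (@unit_itv R)) M R gam f).
      exact: cgam.
    exact: cfun_continuous.
  - rewrite /= g0 g1 fN ge_min le_max; case: (leP 0 (f x)); lra.
  - move=> t _ /= ft; have := fE (gam t); rewrite ft mul0r => /esym c0.
    by have /eqP := fE x; rewrite c0 mulf_eq0 orbb (negPf fx0).
have /eqP : (f x0 - c) * (f x0 + c) = 0 by have := fE x0; nra.
rewrite mulf_eq0 subr_eq0 addr_eq0 => /orP[] /eqP e; [left|right].
  by apply: cfunP => p; rewrite cfun_cst (fC p x0).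
by apply: cfunP => p; rewrite cfun_cst (fC p x0).
Qed.

End Manifold.

(** * Levi-Civita connection and curvature in a Milnor frame *)

Section MilnorFrame.
Variables (R : realType) (n : nat) (M : manifold R n).
Implicit Types (f h : Cinf M) (X Y Z : vfield M).

Lemma lieC X Y : lie X Y = - lie Y X.
Proof.
apply: vfunP => h p; rewrite vfunN.
by change (X (Y h) p - Y (X h) p = - (Y (X h) p - X (Y h) p)); rewrite opprB.
Qed.

Lemma liexx X : lie X X = 0.
Proof.
by apply: vfunP => h p; change (X (X h) p - X (X h) p = 0); exact: subrr.
Qed.

Variables (g : metric M) (D : connection M).
Hypothesis torsion_free : forall X Y, D X Y - D Y X = lie X Y.
Hypothesis metric_compat : forall X Y Z, X (g Y Z) = g (D X Y) Z + g Y (D X Z).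

(** Metric compatibility and torsion freeness turn the right side into terms [g (D _ _) _], which
    cancel except for two copies of [g (D X Y) Z]. *)
Lemma koszul X Y Z :
  2 * g (D X Y) Z = X (g Y Z) + Y (g X Z) - Z (g X Y)
    + g (lie X Y) Z - g (lie Y Z) X - g (lie X Z) Y :> Cinf M.
Proof.
rewrite -!torsion_free !metric_compat !innerE.
rewrite (inner_sym g X (D Y Z)) (inner_sym g Y (D X Z)) (inner_sym g X (D Z Y)).
by ring.
Qed.

Variable E : 'I_3 -> vfield M.
Local Notation E1 := (E idx1).
Local Notation E2 := (E idx2).
Local Notation E3 := (E idx3).
(* For E(kappa, tau), t = tau and c = kappa / (2 tau), so that 2 t c = kappa. *)
Variables t c : R.
Hypothesis orthonormal : forall i j, g (E i) (E j) = (i == j)%:R.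
Hypothesis expansion : forall X,
  X = g X E1 *: E1 + g X E2 *: E2 + g X E3 *: E3.
Hypothesis lie12 : lie E1 E2 = cstC M (2 * t) *: E3.
Hypothesis lie23 : lie E2 E3 = cstC M c *: E1.
Hypothesis lie31 : lie E3 E1 = cstC M c *: E2.

(** Inner products of frame fields are constant, so the three derivative terms of [koszul]
    vanish. *)
Lemma frame_koszul i j k : g (D (E i) (E j)) (E k) = cstC M 2^-1 *
  (g (lie (E i) (E j)) (E k) - g (lie (E j) (E k)) (E i)
   - g (lie (E i) (E k)) (E j)).
Proof.
have cst i' j' Z : Z (g (E i') (E j')) = 0.
  have -> : g (E i') (E j') = cstC M (i' == j')%:R.
    by rewrite orthonormal; apply: cfunP => p; rewrite cfun_cst; case: eqP.
  exact: vfun_cst.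
apply: cfunP => p.
have := congr1 (fun f : Cinf M => f p) (koszul (E i) (E j) (E k)).
by rewrite !cst !cfunE => e; lra.
Qed.

(** A product of equations serves [rewrite] as a single table of rules; the next two lemmas have the
    same form. *)
Lemma orthoE :
  (g E1 E1 = 1) * (g E1 E2 = 0) * (g E1 E3 = 0) *
  (g E2 E1 = 0) * (g E2 E2 = 1) * (g E2 E3 = 0) *
  (g E3 E1 = 0) * (g E3 E2 = 0) * (g E3 E3 = 1).
Proof. by rewrite !orthonormal. Qed.

Lemma lie_frameE :
  (lie E1 E1 = 0) * (lie E2 E2 = 0) * (lie E3 E3 = 0) *
  (lie E1 E2 = cstC M (2 * t) *: E3) * (lie E2 E1 = - (cstC M (2 * t) *: E3)) *
  (lie E2 E3 = cstC M c *: E1) * (lie E3 E2 = - (cstC M c *: E1)) *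
  (lie E3 E1 = cstC M c *: E2) * (lie E1 E3 = - (cstC M c *: E2)).
Proof.
by rewrite !liexx (lieC E2 E1) (lieC E3 E2) (lieC E1 E3) lie12 lie23 lie31.
Qed.

Lemma nabla_frameE :
  (D E1 E1 = 0) * (D E2 E2 = 0) * (D E3 E3 = 0) *
  (D E1 E2 = cstC M t *: E3) * (D E2 E1 = cstC M (- t) *: E3) *
  (D E2 E3 = cstC M t *: E1) * (D E3 E2 = cstC M (t - c) *: E1) *
  (D E3 E1 = cstC M (c - t) *: E2) * (D E1 E3 = cstC M (- t) *: E2).
Proof.
by do !split; rewrite [LHS]expansion !frame_koszul !lie_frameE !innerE !orthoE;
  apply: vfunP => h p; rewrite !vfunE !cfunE; field.
Qed.

(** Tensoriality in the second and third arguments makes the curvature a quadratic form in the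
    components of [X]. *)
Lemma curvature_expansion Y X :
  let a i := g X (E i) in let K i j := curvature D Y (E i) (E j) in
  curvature D Y X X =
    a idx1 *: (a idx1 *: K idx1 idx1 + a idx2 *: K idx1 idx2
               + a idx3 *: K idx1 idx3) +
    a idx2 *: (a idx1 *: K idx2 idx1 + a idx2 *: K idx2 idx2
               + a idx3 *: K idx2 idx3) +
    a idx3 *: (a idx1 *: K idx3 idx1 + a idx2 *: K idx3 idx2
               + a idx3 *: K idx3 idx3).
Proof.
move=> a K.
have Km Z : curvature D Y X Z = a idx1 *: curvature D Y E1 Z +
    a idx2 *: curvature D Y E2 Z + a idx3 *: curvature D Y E3 Z.
  rewrite {1}(expansion X) !(curvatureDm torsion_free).
  by rewrite !(curvatureZm torsion_free).
have Kr Z : curvature D Y Z X = a idx1 *: curvature D Y Z E1 +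
    a idx2 *: curvature D Y Z E2 + a idx3 *: curvature D Y Z E3.
  by rewrite {1}(expansion X) !curvatureDr !curvatureZr.
by rewrite Km !Kr.
Qed.

(* The sectional curvatures are t^2 on the planes containing E3 and
   2 t c - 3 t^2 on the plane spanned by E1 and E2. *)
Lemma curvature_frame1 X : g (curvature D E1 X X) E1 =
  cstC M (t ^+ 2) * g X E3 ^+ 2 + cstC M (2 * t * c - 3 * t ^+ 2) * g X E2 ^+ 2.
Proof.
rewrite curvature_expansion /curvature !lie_frameE !nablaE !nabla_frameE !nablaE.
rewrite !nabla_frameE !innerE !orthoE.
by apply: cfunP => p; rewrite !cfunE; ring.
Qed.

Lemma curvature_frame2 X : g (curvature D E2 X X) E2 =
  cstC M (t ^+ 2) * g X E3 ^+ 2 + cstC M (2 * t * c - 3 * t ^+ 2) * g X E1 ^+ 2.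
Proof.
rewrite curvature_expansion /curvature !lie_frameE !nablaE !nabla_frameE !nablaE.
rewrite !nabla_frameE !innerE !orthoE.
by apply: cfunP => p; rewrite !cfunE; ring.
Qed.

Lemma curvature_frame3 X : g (curvature D E3 X X) E3 =
  cstC M (t ^+ 2) * (g X E1 ^+ 2 + g X E2 ^+ 2).
Proof.
rewrite curvature_expansion /curvature !lie_frameE !nablaE !nabla_frameE !nablaE.
rewrite !nabla_frameE !innerE !orthoE.
by apply: cfunP => p; rewrite !cfunE; ring.
Qed.

Lemma frame_ext X Y : g X E1 = g Y E1 -> g X E2 = g Y E2 -> g X E3 = g Y E3 ->
  X = Y.
Proof. by move=> e1 e2 e3; rewrite (expansion X) (expansion Y) e1 e2 e3. Qed.

Hypothesis t_neq0 : t != 0.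
Hypothesis curv_neq : 2 * t * c != 4 * t ^+ 2.
Hypothesis scM : simply_connected R M.

(** * Rigidity of compatible trans-Sasakian structures *)

Section TransSasakian.
Variables (S : almost_contact g) (alpha beta : Cinf M).
Hypothesis tS : trans_sasakian_type D S alpha beta.

(** At each point, [curvature_xi] on the three frame fields and the unit length of [xi] give four
    equations in the components [u], [v], [w] of [xi] and the factor [F]. *)
Lemma xi_no_horizontal_part : g (xi S) E1 = 0 /\ g (xi S) E2 = 0.
Proof.
have ev (f h : Cinf M) p : f = h -> f p = h p by move=> ->.
have all12 p : g (xi S) E1 p = 0 /\ g (xi S) E2 p = 0.
  have := ev _ _ p (inner_xi S).
  rewrite {2}(expansion (xi S)) !innerE.
  have := ev _ _ p (curvature_xi torsion_free metric_compat tS E1).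
  have := ev _ _ p (curvature_xi torsion_free metric_compat tS E2).
  have := ev _ _ p (curvature_xi torsion_free metric_compat tS E3).
  rewrite curvature_frame1 curvature_frame2 curvature_frame3 !orthoE.
  rewrite ![g (E _) (xi S)]inner_sym.
  set F := alpha ^+ 2 - _ - _.
  move: (g (xi S) E1) (g (xi S) E2) (g (xi S) E3) F => u v w F.
  rewrite !cfunE; move: (u p) (v p) (w p) (F p) => {}u {}v {}w {}F.
  move=> e3 e2 e1 e0.
  have k0 : 2 * t * c - 4 * t ^+ 2 != 0 by rewrite subr_eq0.
  (* Since [1 - w ^+ 2 = u ^+ 2 + v ^+ 2], this is the equation from [E3]. *)
  have /eqP : (F - t ^+ 2) * (u ^+ 2 + v ^+ 2) = 0.
    have uv : u * u + v * v = 1 - w * w by lra.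
    by move: e3; rewrite !expr2 uv mulrBl => ->; rewrite subrr.
  rewrite mulf_eq0 subr_eq0 => /orP[/eqP FE|/eqP].
    (* With [F = t ^+ 2], the unit length relation times [t ^+ 2] turns the equations from [E1] and
       [E2] into [v ^+ 2] and [u ^+ 2] times the nonzero [2 * t * c - 4 * t ^+ 2]. The product is
       formed beforehand to keep the problem linear for [lra]. *)
    have e0' : t ^+ 2 * (u * u + v * v + w * w) = t ^+ 2 by rewrite e0 mulr1.
    rewrite FE in e1 e2.
    have /eqP : (2 * t * c - 4 * t ^+ 2) * v ^+ 2 = 0 by lra.
    have /eqP : (2 * t * c - 4 * t ^+ 2) * u ^+ 2 = 0 by lra.
    rewrite mulf_eq0 (negPf k0) sqrf_eq0 => /eqP ->.
    by rewrite mulf_eq0 (negPf k0) sqrf_eq0 => /eqP ->.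
  have := sqr_ge0 u; have := sqr_ge0 v => v0 u0 uv.
  have /eqP : u ^+ 2 = 0 by lra.
  have /eqP : v ^+ 2 = 0 by lra.
  by rewrite !sqrf_eq0 => /eqP -> /eqP ->.
by split; apply: cfunP => p; case: (all12 p) => h1 h2; rewrite ?h1 ?h2.
Qed.

Lemma xi_vertical : xi S = g (xi S) E3 *: E3.
Proof.
have [h1 h2] := xi_no_horizontal_part.
by rewrite {1}(expansion (xi S)) h1 h2 !scale0r !add0r.
Qed.

Lemma xi_eq_sign : exists2 s : R, s ^+ 2 = 1 & xi S = cstC M s *: E3.
Proof.
have : g (xi S) E3 * g (xi S) E3 = cstC M (1 ^+ 2).
  have := inner_xi S; rewrite {1 2}xi_vertical innerZl innerZr orthoE mulr1 => ->.
  by rewrite expr1n cstC1.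
case/(cfun_sqr_cst scM) => e; rewrite xi_vertical e.
  by exists 1; rewrite ?expr1n.
by exists (- 1); rewrite ?sqrrN ?expr1n.
Qed.

Lemma trans_sasakian_coef : beta = 0 /\ nonzero_constant alpha.
Proof.
have [s s2 xiE] := xi_eq_sign.
have xiE1 : g E1 (xi S) = 0 by rewrite xiE !innerE orthoE mulr0.
have eE1 : Defs.eta S E1 = 0 by rewrite eta_inner.
have b0 : beta = 0.
  (* Pairing with [E1] kills [D E1 xi], a multiple of [E2], and [ph E1]; as [ph (ph E1) = - E1],
     only [beta] remains. *)
  have := congr1 (fun Z => g Z E1) (nabla_xi metric_compat tS E1).
  rewrite /= {1}xiE !nablaE nabla_frameE !innerE !orthoE inner_phi phi_phi eE1.
  rewrite scale0r !innerE orthoE => e; apply: cfunP => p.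
  by have := congr1 (fun f : Cinf M => f p) e; rewrite !cfunE; lra.
split=> //.
have := nabla_xi metric_compat tS E1.
rewrite b0 scale0r subr0 {1}xiE !nablaE nabla_frameE => nE.
(* Squared lengths are compared: [ph E1] is a unit field, so its direction does not matter. *)
have := congr1 (fun Z => g Z Z) nE.
rewrite /= !innerE !orthoE phi_metric eE1 orthoE => e.
have aa : alpha * alpha = cstC M (t ^+ 2).
  apply: cfunP => p; have := congr1 (fun f : Cinf M => f p) e; rewrite !cfunE.
  by move: s2; nra.
case: (cfun_sqr_cst scM aa) => ->; [exists t|exists (- t)] => //.
by rewrite oppr_eq0.
Qed.

End TransSasakian.

(** * The canonical structures, one for each sign [s] *)

Section Canonical.
Variable s : R.
Hypothesis s2 : s ^+ 2 = 1.

Lemma cst_sqr_s : cstC M s ^+ 2 = 1.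
Proof. by apply: cfunP => p; rewrite !cfunE. Qed.

(* As alpha = tau, nabla xi = - alpha phi forces phi X = - nabla_X xi / tau. *)
Definition canon_phi X : vfield M :=
  cstC M s *: (g X E1 *: E2 - g X E2 *: E1).
Lemma canon_phi_linear : linear canon_phi.
Proof.
by move=> f X Y; apply: frame_ext; rewrite /canon_phi !innerE !orthoE; ring.
Qed.

HB.instance Definition _ := GRing.isLinear.Build (Cinf M) (vfield M) (vfield M)
  *:%R canon_phi canon_phi_linear.

Definition canon_eta X : (Cinf M)^o := cstC M s * g X E3.
Lemma canon_eta_linear : linear canon_eta.
Proof.
move=> f X Y; rewrite /canon_eta !innerE.
change (cstC M s * (f * g X E3 + g Y E3) =
        f * (cstC M s * g X E3) + cstC M s * g Y E3).
by ring.
Qed.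

HB.instance Definition _ := GRing.isLinear.Build (Cinf M) (vfield M) (Cinf M)^o
  *:%R canon_eta canon_eta_linear.

Definition canon_xi : vfield M := cstC M s *: E3.

Lemma canon_phi_phi X :
  canon_phi (canon_phi X) = - X + (canon_eta X : Cinf M) *: canon_xi.
Proof.
apply: frame_ext; rewrite /canon_phi /canon_eta /canon_xi !innerE !orthoE;
  by ring: cst_sqr_s.
Qed.

Lemma canon_eta_xi : canon_eta canon_xi = 1.
Proof.
by rewrite /canon_eta /canon_xi !innerE !orthoE mulr1; exact: cst_sqr_s.
Qed.

Lemma canon_phi_xi : canon_phi canon_xi = 0.
Proof.
by rewrite /canon_phi /canon_xi !innerE !orthoE !mulr0 !scale0r subr0 scaler0.
Qed.

Lemma canon_eta_phi X : canon_eta (canon_phi X) = 0.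
Proof.
by rewrite /canon_eta /canon_phi !innerE !orthoE !mulr0 subr0 !mulr0.
Qed.

Lemma canon_phi_metric X Y :
  g (canon_phi X) (canon_phi Y) = g X Y - canon_eta X * canon_eta Y.
Proof.
rewrite {2}(expansion X) /canon_eta /canon_phi !innerE !orthoE.
by rewrite !(inner_sym g (E _)); ring: cst_sqr_s.
Qed.

Definition canonical_structure : almost_contact g :=
  @AlmostContact _ _ _ g canon_phi canon_xi canon_eta canon_phi_phi canon_eta_xi
    canon_phi_xi canon_eta_phi canon_phi_metric.

(** Both [xi] and [phi] carry the factor [s], so [alpha] is [t] for either sign. *)
Lemma canonical_trans_sasakian :
  trans_sasakian_type D canonical_structure (cstC M t) 0.
Proof.
move=> X Y; rewrite scale0r addr0 /=.
have nX i : D X (E i) =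
    g X E1 *: D E1 (E i) + g X E2 *: D E2 (E i) + g X E3 *: D E3 (E i).
  by rewrite {1}(expansion X) !nablaE.
(* In this form the derivatives of the components of [Y] cancel between the two terms on the left,
   leaving a polynomial identity in the components of [X] and [Y]. *)
have compat i : g (D X Y) (E i) = X (g Y (E i)) - g Y (D X (E i)).
  by rewrite metric_compat addrK.
have gXY : g X Y = g X E1 * g Y E1 + g X E2 * g Y E2 + g X E3 * g Y E3.
  by rewrite {1}(expansion X) !innerE !(inner_sym g (E _)).
rewrite /canon_phi /canon_eta /canon_xi !nablaE !nabla_leibniz !compat !nX.
rewrite !nabla_frameE gXY.
by apply: frame_ext; rewrite !innerE !orthoE ?cstCN; ring.
Qed.

End Canonical.

End MilnorFrame.

(** * Application to the spaces E(kappa, tau) *)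

Lemma Ekt_expansion (R : realType) (kappa tau : R) (M : Ekt kappa tau)
    (X : vfield M) (g := Emetric M) (E := Efr M) :
  X = g X (E idx1) *: E idx1 + g X (E idx2) *: E idx2 + g X (E idx3) *: E idx3.
Proof.
rewrite {1}(orthonormal_expansion (@E_frame _ _ _ M) (E_orthonormal M) X).
rewrite !big_ord_recl big_ord0 addr0 addrA.
(* Unfolding the sum yields iterated lifts of [ord0], which have the same values as the named
   indices. *)
have [-> -> ->] // : [/\ lift ord0 (lift ord0 ord0) = idx3,
    lift ord0 ord0 = idx2 & ord0 = idx1 ] by split; exact: val_inj.
Qed.

Theorem theorem6p3 (R : realType) (kappa tau : R)
  (htau : tau != 0) (hkappa : kappa != 4 * tau ^+ 2)
  (M : Ekt kappa tau) (D : connection M) (hD : levi_civita (Emetric M) D) :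
  (* every compatible trans-Sasakian structure is vertical (M is connected) *)
  (forall S : almost_contact (Emetric M), trans_sasakian D S ->
     vertical (xi S) /\ (xi S = E3 M \/ xi S = - E3 M)) /\
  (* none is proper *)
  ~ (exists S : almost_contact (Emetric M), proper_trans_sasakian D S) /\
  (* they are exactly the canonical vertical alpha-Sasakian structures *)
  (forall (S : almost_contact (Emetric M)) (alpha beta : Cinf M),
     trans_sasakian_type D S alpha beta ->
     [/\ xi S = E3 M \/ xi S = - E3 M, beta = 0 & nonzero_constant alpha]) /\
  (* which exist, for both orientations of the fibres *)
  (exists S : almost_contact (Emetric M), xi S = E3 M /\ alpha_sasakian D S) /\
  (exists S : almost_contact (Emetric M), xi S = - E3 M /\ alpha_sasakian D S).
Proof.
have [tf mc] := hD.
have b12 := E_bracket12 M; have b23 := E_bracket23 M; have b31 := E_bracket31 M.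
have orth := E_orthonormal M; have expn := @Ekt_expansion _ _ _ M.
have scM := E_simply_connected M.
have curv : 2 * tau * (kappa / (2 * tau)) != 4 * tau ^+ 2.
  by have -> : 2 * tau * (kappa / (2 * tau)) = kappa by field.
have scaleE3 (s : R) : s = 1 \/ s = -1 ->
    cstC M s *: E3 M = E3 M \/ cstC M s *: E3 M = - E3 M.
  by case=> ->; [left|right]; rewrite ?cstCN cstC1 ?scaleN1r ?scale1r.
have main (S : almost_contact (Emetric M)) alpha beta :
    trans_sasakian_type D S alpha beta ->
    [/\ xi S = E3 M \/ xi S = - E3 M, beta = 0 & nonzero_constant alpha].
  move=> tS.
  have [b0 a0] :=
    trans_sasakian_coef tf mc orth expn b12 b23 b31 htau curv scM tS.
  split=> //.
  have [s s2 ->] := xi_eq_sign tf mc orth expn b12 b23 b31 curv scM tS.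
  apply: scaleE3; move/eqP: s2.
  by rewrite sqrf_eq1 => /orP[] /eqP ->; [left|right].
have canon (s : R) : s ^+ 2 = 1 -> exists S : almost_contact (Emetric M),
    xi S = cstC M s *: E3 M /\ alpha_sasakian D S.
  move=> s2; exists (canonical_structure orth expn s2); split=> //.
  exists (cstC M tau); last by exists tau.
  exact: (canonical_trans_sasakian tf mc orth expn b12 b23 b31).
split; [|split; [|split; [exact: main|split]]].
- move=> S [alpha [beta tS]]; have [xiE _ _] := main _ _ _ tS.
  split=> // p; case: xiE => ->; [exists 1 => f|exists (- 1) => f].
    by rewrite mul1r.
  by rewrite vfunN mulN1r.
(* By [main] a trans-Sasakian structure is already [alpha_sasakian], which properness excludes. *)
- move=> [S [[alpha [beta tS]] nS _ _]]; have [_ b0 a0] := main _ _ _ tS.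
  by apply: nS; exists alpha => //; rewrite -b0.
- by have [S [xS aS]] := canon 1 (expr1n _ _); exists S; rewrite xS cstC1 scale1r.
- have [|S [xS aS]] := canon (- 1); first by rewrite sqrrN expr1n.
  by exists S; rewrite xS cstCN cstC1 scaleN1r.
Qed.
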